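(* Let $A$ be a pseudo-BCK algebra and let $v$ be a very true operator on $A$. If $\varphi:A\to\mathbb{R}$ is a pseudo-valuation on $A$, then $\varphi_v=\varphi\circ v:A\to\mathbb{R}$ is a pseudo-valuation on $A$.
   Context: A pseudo-BCK algebra is a structure $(A,\leq,\rightarrow,\rightsquigarrow,1)$ where $\leq$ is a binary relation on $A$, $\rightarrow$ and $\rightsquigarrow$ are binary operations on $A$ and $1\in A$, such that for all $x,y,z\in A$: $x\rightarrow y\leq (y\rightarrow z)\rightsquigarrow (x\rightarrow z)$ and $x\rightsquigarrow y\leq (y\rightsquigarrow z)\rightarrow (x\rightsquigarrow z)$; $x\leq (x\rightarrow y)\rightsquigarrow y$ and $x\leq (x\rightsquigarrow y)\rightarrow y$; $x\leq x$; $x\leq 1$; if $x\leq y$ and $y\leq x$ then $x=y$; $x\leq y$ iff $x\rightarrow y=1$ iff $x\rightsquigarrow y=1$. A very true operator on a pseudo-BCK algebra $A$ is a map $v:A\to A$ such that for all $x,y\in A$: $v(1)=1$; $v(x)\leq x$; $v(x)\leq v(v(x))$; $v(x\rightarrow y)\leq v(x)\rightarrow v(y)$ and $v(x\rightsquigarrow y)\leq v(x)\rightsquigarrow v(y)$. A pseudo-valuation on $A$ is a function $\varphi:A\to\mathbb{R}$ with $\varphi(1)=0$ and $\varphi(y)-\varphi(x)\leq\min\{\varphi(x\rightarrow y),\varphi(x\rightsquigarrow y)\}$ for all $x,y\in A$. *)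

(* Defs.v *)
From Stdlib Require Import Reals.

Declare Scope pbck_scope.
Delimit Scope pbck_scope with pbck.

Record pseudoBCK : Type := PseudoBCK {
  bck_carrier :> Type;
  bck_le : bck_carrier -> bck_carrier -> Prop;
  bck_imp : bck_carrier -> bck_carrier -> bck_carrier;
  bck_simp : bck_carrier -> bck_carrier -> bck_carrier;
  bck_one : bck_carrier;
  bck_imp_trans : forall x y z,
    bck_le (bck_imp x y) (bck_simp (bck_imp y z) (bck_imp x z));
  bck_simp_trans : forall x y z,
    bck_le (bck_simp x y) (bck_imp (bck_simp y z) (bck_simp x z));
  bck_le_imp_simp : forall x y, bck_le x (bck_simp (bck_imp x y) y);
  bck_le_simp_imp : forall x y, bck_le x (bck_imp (bck_simp x y) y);
  bck_le_refl : forall x, bck_le x x;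
  bck_le_one : forall x, bck_le x bck_one;
  bck_le_antisym : forall x y, bck_le x y -> bck_le y x -> x = y;
  bck_le_iff_imp : forall x y, bck_le x y <-> bck_imp x y = bck_one;
  bck_le_iff_simp : forall x y, bck_le x y <-> bck_simp x y = bck_one
}.

Arguments bck_le {p} _ _.
Arguments bck_imp {p} _ _.
Arguments bck_simp {p} _ _.
Arguments bck_one {p}.

Notation "x <= y" := (bck_le x y) : pbck_scope.
Notation "x ~> y" := (bck_imp x y)
  (at level 55, right associativity) : pbck_scope.
Notation "x ~~> y" := (bck_simp x y)
  (at level 55, right associativity) : pbck_scope.

Record very_true {A : pseudoBCK} (v : A -> A) : Prop := VeryTrue {
  vt_one : v bck_one = bck_one;
  vt_le : forall x, (v x <= x)%pbck;
  vt_idem : forall x, (v x <= v (v x))%pbck;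
  vt_imp : forall x y, (v (x ~> y) <= v x ~> v y)%pbck;
  vt_simp : forall x y, (v (x ~~> y) <= v x ~~> v y)%pbck
}.

Record pseudo_valuation {A : pseudoBCK} (phi : A -> R) : Prop :=
  PseudoValuation {
  pv_one : phi bck_one = 0%R;
  pv_le : forall x y : A,
    (phi y - phi x <= Rmin (phi (x ~> y)%pbck) (phi (x ~~> y)%pbck))%R
}.

(* Main.v *)
Require Import Defs.
From Stdlib Require Import Reals Lra.

(** A pseudo-valuation reverses the order, since [x <= y] makes [x ~> y] equal
    to [1], where the valuation vanishes.  A very true operator only
    subdistributes over each implication, [v (x ~> y) <= v x ~> v y], and this
    is the useful direction: an order-reversing [phi] gives
    [phi (v x ~> v y) <= phi (v (x ~> y))], so the bound that [phi] satisfies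
    at the pair [v x], [v y] weakens to the one required of the composite at
    [x], [y]. *)

Lemma pseudo_valuation_antitone (A : pseudoBCK) (phi : A -> R) (x y : A) :
  pseudo_valuation phi -> (x <= y)%pbck -> (phi y <= phi x)%R.
Proof.
  intros hphi hxy.
  pose proof (pv_le phi hphi x y) as h.
  rewrite (proj1 (bck_le_iff_imp A x y) hxy) in h.
  rewrite (proj1 (bck_le_iff_simp A x y) hxy) in h.
  rewrite (pv_one phi hphi), Rmin_left in h; lra.
Qed.

Theorem theorem4p20 (A : pseudoBCK) (v : A -> A) (hv : very_true v)
    (phi : A -> R) (hphi : pseudo_valuation phi) :
  pseudo_valuation (fun x : A => phi (v x)).
Proof.
  split.
  - rewrite (vt_one v hv). apply (pv_one phi hphi).
  - intros x y.
    eapply Rle_trans; [apply (pv_le phi hphi) |].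
    eapply Rle_trans; [apply Rle_min_compat_r | apply Rle_min_compat_l].
    + apply pseudo_valuation_antitone; [exact hphi | apply (vt_imp v hv)].
    + apply pseudo_valuation_antitone; [exact hphi | apply (vt_simp v hv)].
Qed.
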